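(* Let $I=[0,\gamma)$ with $0<\gamma\le\infty$. Let $\varphi$ be an Orlicz function that satisfies the $\Delta_2$-condition if $\gamma=\infty$, and the $\Delta_2^\infty$-condition if $\gamma<\infty$. Let $w_1,w_2$ be weight functions on $I$ and put $W_i(t)=\int_0^t w_i(s)\,ds$ for $i=1,2$. Then the following statements are equivalent: (i) there exists a constant $K>0$ such that $W_2(t)\le K\,W_1(t)$ for all $t\in I$; (ii) $\Lambda_{\varphi,w_1}\subset\Lambda_{\varphi,w_2}$ and the inclusion map is continuous.
   Context: The interval $I=[0,\gamma)$ carries Lebesgue measure $m$. $L_0$ is the space of real Lebesgue measurable functions on $I$ modulo a.e. equality. For $f\in L_0$, $d_f(\lambda)=m(\{t\in I:|f(t)|>\lambda\})$ for $\lambda>0$, and $f^*(t)=\inf\{\lambda>0:d_f(\lambda)\le t\}$ for $t\ge 0$ (with $\inf\varnothing=\infty$). An Orlicz function is a convex function $\varphi:[0,\infty)\to[0,\infty)$ with $\varphi(0)=0=\lim_{u\to0}\varphi(u)$ and $\varphi(u)>0$ for $u>0$ (put $\varphi(\infty)=\infty$). It satisfies the $\Delta_2^\infty$-condition if there are $K>2$ and $u_0\ge0$ with $\varphi(2u)\le K\varphi(u)$ for all $u\ge u_0$; the $\Delta_2^0$-condition if there are $K>2$ and $u_0>0$ with $\varphi(2u)\le K\varphi(u)$ for all $0\le u\le u_0$; and the $\Delta_2$-condition if it satisfies both. A weight function on $I$ is a positive, decreasing (i.e. nonincreasing) function $w:I\setminus\{0\}\to(0,\infty)$ with $W(t)=\int_0^t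 w(s)\,ds<\infty$ for every $t\in I$; if $\gamma=\infty$ it is also assumed that $\int_0^\infty w=\infty$. The modular is $\rho_{\varphi,w}(f)=\int_I\varphi(f^*(t))w(t)\,dt$. The Orlicz-Lorentz space is $\Lambda_{\varphi,w}=\{f\in L_0:\rho_{\varphi,w}(kf)<\infty\text{ for some }k>0\}$, equipped with the Luxemburg norm $\|f\|_{\varphi,w}=\inf\{\varepsilon>0:\rho_{\varphi,w}(f/\varepsilon)\le1\}$ (a Banach space). *)

(* Defs.v *)
From HB Require Import structures.
From mathcomp Require Import all_boot all_order all_algebra.
From mathcomp Require Import all_classical all_reals all_analysis.
Import Order.TTheory GRing.Theory Num.Theory.
Import numFieldNormedType.Exports.

Set Implicit Arguments.
Unset Strict Implicit.
Unset Printing Implicit Defensive.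

Local Open Scope classical_set_scope.
Local Open Scope ring_scope.

(* The real line with the sigma-algebra of Lebesgue measurable sets, i.e. the
   sets that are Caratheodory-measurable for the Lebesgue outer measure. *)
Definition lebesgueType (R : realType) :=
  caratheodory_type ((wlength (@idfun R))^*)%mu.

Section interval.
Context {R : realType}.
Variable gamma : \bar R.

Definition base_itv : set R := [set t | 0 <= t /\ (t%:E < gamma)%E].

Definition base_itv0 : set R := base_itv `\ 0.

Lemma measurable_base_itv : measurable (base_itv : set (lebesgueType R)).
Proof.
suff [A mA ->] : exists2 A : set (measurableTypeR R), measurable A & base_itv = A.
  exact: sub_caratheodory.
exists base_itv => //; rewrite /base_itv; case: gamma => [r| |].
- rewrite (_ : [set t | _] = `[0, r[%classic) //.
  by apply/seteqP; split=> t /=; rewrite in_itv/= lte_fin => /andP.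
- rewrite (_ : [set t | _] = `[0, +oo[%classic) //.
  by apply/seteqP; split=> t /=; rewrite in_itv/= andbT ?ltry => // -[].
- by rewrite (_ : [set t | _] = set0) //; apply/seteqP; split=> t //= -[].
Qed.

Definition leb_itv : {measure set (lebesgueType R) -> \bar R} :=
  mrestr (@completed_lebesgue_measure R) measurable_base_itv.

(* An element is a class of functions on the whole line for equality
   leb_itv-a.e.: the values outside [0, gamma) are irrelevant. *)
Definition L0 : Type := {mfun_ leb_itv, lebesgueType R >-> R}.

Definition L0_fun (f : L0) : R -> R := aqEqMfun_to_fun f.
Coercion L0_fun : L0 >-> Funclass.

(* Distribution, rearrangement, modular and norm are defined on functions; they
   are invariant under a.e. equality on [0, gamma), and elements of L0 coerce
   to functions by taking a representative. *)
Definition distr_fun (f : R -> R) (lambda : R) : \bar R :=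
  leb_itv [set t | lambda < `|f t|].

Lemma distr_fun_ae (f g : {mfun lebesgueType R >-> R}) (lambda : R) :
  f = g %[ae leb_itv] -> distr_fun f lambda = distr_fun g lambda.
Proof.
suff le (h k : {mfun lebesgueType R >-> R}) : h = k %[ae leb_itv] ->
    (distr_fun h lambda <= distr_fun k lambda)%E.
  move=> fg; apply/eqP; rewrite eq_le !le//.
  by apply: filterS fg => x /= + Ix => ->.
move=> hk; rewrite /distr_fun.
have mS (l : {mfun lebesgueType R >-> R}) :
    measurable ([set t | lambda < `|l t|] : set (lebesgueType R)).
  rewrite (_ : [set t | _] = (@Num.norm _ R \o l) @^-1` `]lambda, +oo[%classic).
    have ml : measurable_fun [set: lebesgueType R] (@Num.norm _ R \o l).
      by apply: measurableT_comp => //; exact: measurable_funPT.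
    by rewrite -[X in measurable X]setTI; exact: ml.
  by apply/seteqP; split=> t /=; rewrite in_itv/= andbT.
set A := [set t | _]; set B := [set t | lambda < `|k t|].
have AB0 : leb_itv (A `\` B) = 0%E.
  apply: measure_negligible; first by apply: measurableD; exact: mS.
  case: hk => N [mN N0 hN]; exists N; split => // t [/= At nBt].
  apply: hN => /= hkt; apply: nBt.
  by rewrite /B/= -(hkt Logic.I).
rewrite -[leRHS]add0e -AB0.
apply: (@le_trans _ _ (leb_itv ((A `\` B) `|` B))); last first.
  by apply: measureU2; [apply: measurableD|]; exact: mS.
apply: le_measure; rewrite ?inE; first exact: mS.
- by apply: measurableU; [apply: measurableD|]; exact: mS.
- by move=> t At; have [Bt|Bt] := pselect (B t); [right|left].
Qed.

Definition rearrangement (f : R -> R) (t : R) : \bar R :=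
  ereal_inf [set lambda%:E | lambda in
    [set lambda : R | 0 < lambda /\ (distr_fun f lambda <= t%:E)%E]].

(* phi is extended by phi +oo = +oo; the value at -oo is never used *)
Definition extend_oo (phi : R -> R) (x : \bar R) : \bar R :=
  if x is r%:E then (phi r)%:E else +oo%E.

(* The integrand is a product of monotone functions on (0, gamma), hence Borel,
   so its integral for the Borel and the completed measure is the same. *)
Definition modular (phi w f : R -> R) : \bar R :=
  (\int[lebesgue_measure]_(t in base_itv0)
     (extend_oo phi (rearrangement f t) * (w t)%:E))%E.

Definition orlicz_lorentz (phi w : R -> R) : set L0 :=
  [set f : L0 | exists2 k : R, 0 < k &
     (modular phi w (fun t => k * f t)%R < +oo)%E].

Definition luxemburg (phi w f : R -> R) : \bar R :=
  ereal_inf [set eps%:E | eps in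
    [set eps : R | 0 < eps /\ (modular phi w (fun t => f t / eps)%R <= 1)%E]].

Definition luxemburg_continuous (phi w1 w2 : R -> R) (T : L0 -> L0) : Prop :=
  forall f : L0, orlicz_lorentz phi w1 f ->
  forall eps : R, 0 < eps ->
  exists2 delta : R, 0 < delta &
    forall g : L0, orlicz_lorentz phi w1 g ->
      (luxemburg phi w1 (fun t => g t - f t)%R < delta%:E)%E ->
      (luxemburg phi w2 (fun t => T g t - T f t)%R < eps%:E)%E.

Definition weight_int (w : R -> R) (t : R) : \bar R :=
  (\int[lebesgue_measure]_(s in `]0%R, t[) (w s)%:E)%E.

Record weight_fun (w : R -> R) : Prop := Weight {
  weight_gt0 : forall t, base_itv0 t -> 0 < w t;
  weight_noninc : forall s t, base_itv0 s -> base_itv0 t -> s <= t -> w t <= w s;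
  weight_fin : forall t, base_itv t -> (weight_int w t < +oo)%E;
  weight_oo : gamma = +oo%E ->
    (\int[lebesgue_measure]_(s in `]0%R, +oo[) (w s)%:E = +oo)%E }.

End interval.

Arguments orlicz_lorentz {R} gamma phi w _.
Arguments luxemburg_continuous {R} gamma phi w1 w2 T.

Section orlicz.
Context {R : realType}.
Variable phi : R -> R.

Record orlicz_fun : Prop := Orlicz {
  orlicz_ge0 : forall u, 0 <= u -> 0 <= phi u;
  orlicz_convex : convex_function (`[0, +oo[%classic : set R) phi;
  orlicz0 : phi 0 = 0;
  orlicz_cvg0 : phi u @[u --> 0^'+] --> (0 : R);
  orlicz_gt0 : forall u, 0 < u -> 0 < phi u }.

Definition delta2_oo : Prop :=
  exists K u0 : R, [/\ 2 < K, 0 <= u0 &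
    forall u, u0 <= u -> phi (2 * u) <= K * phi u].

Definition delta2_0 : Prop :=
  exists K u0 : R, [/\ 2 < K, 0 < u0 &
    forall u, 0 <= u <= u0 -> phi (2 * u) <= K * phi u].

Definition delta2 : Prop := delta2_oo /\ delta2_0.

End orlicz.

(* Main.v *)
From HB Require Import structures.
Require Import Defs.
From mathcomp Require Import all_boot all_order all_algebra.
From mathcomp Require Import all_classical all_reals all_analysis.
From mathcomp Require Import measurable_realfun ring.
Import Order.TTheory GRing.Theory Num.Theory.
Import numFieldNormedType.Exports.

(** Write W1, W2 for the primitives of w1, w2, and f^* for the decreasing
    rearrangement of f.

    From W2 <= K W1 to the embedding. The composite of phi and f^* is nonincreasing,
    so each of its superlevel sets is an initial segment of the interval, on
    which the integral of w2 is at most K times that of w1. Integrating over the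
    levels (the layer cake formula) compares the modulars
    ([weighted_integral_le], [modular_le_weight]). Convexity and phi 0 = 0 give
    phi (c u) <= c phi u for c in [0, 1], which turns the factor K between the
    modulars into a factor between the Luxemburg norms ([modular_scale],
    [weight_int_le_embedding]).

    From continuity to W2 <= K W1. The function u 1_[0,t) is its own
    rearrangement, so its modular is phi u * W t ([modular_step]). Continuity at
    zero therefore provides a constant C such that phi (C u) * W1 t <= 1 implies
    phi u * W2 t <= 1 ([luxemburg_continuous_step]). For fixed t choose s with
    phi s * W1 t <= 1 < phi (2 s) * W1 t ([orlicz_crossing]) and take u = s / C:
    then W2 t <= 1 / phi (s / C), while 1 / phi (2 s) < W1 t. The growth
    condition bounds phi (2 s) by a multiple of phi (s / C). When gamma is
    finite, doubling is available only for large arguments, but W1 is then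
    bounded, which keeps phi (2 s), hence s, away from zero
    ([delta2_region]); the pieces meet in [embedding_weight_int_le]. *)

Set Implicit Arguments.
Unset Strict Implicit.
Unset Printing Implicit Defensive.

Local Open Scope classical_set_scope.
Local Open Scope ring_scope.

(** * Layer cake formula and monotone functions *)

Section layer_cake.
Local Open Scope ereal_scope.
Context d (T : measurableType d) (R : realType).
Variable nu : {sigma_finite_measure set T -> \bar R}.
Notation mu := (@lebesgue_measure R).

Lemma lebesgue_measure_below (y : \bar R) : 0 <= y ->
  mu [set l : R | (0 <= l)%R /\ l%:E < y] = y.
Proof.
case: y => [r| |] //.
- rewrite lee_fin => r0; rewrite (_ : [set l | _] = `[0%R, r[%classic).
    by rewrite lebesgue_measure_itv/= lte_fin sube0; case: ltgtP r0 => // <-.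
  by apply/seteqP; split=> l /=; rewrite in_itv/= lte_fin => /andP.
- move=> _; rewrite (_ : [set l | _] = `[0%R, +oo[%classic).
    by rewrite lebesgue_measure_itv/= ltry.
  by apply/seteqP; split=> l /=; rewrite in_itv/= andbT ?ltry => // -[].
Qed.

(** Tonelli applied to the indicator of the region under the graph of h,
    weighted by w: for fixed x the levels below h x have length h x. *)
Lemma ge0_integral_layer_cake (D : set T) (h w : T -> \bar R) :
  measurable D -> measurable_fun D h -> measurable_fun D w ->
  (forall x, D x -> 0 <= h x) -> (forall x, D x -> 0 <= w x) ->
  \int[nu]_(x in D) (h x * w x) =
  \int[mu]_(l in `[0%R, +oo[) \int[nu]_(x in D `&` [set x | l%:E < h x]) w x.
Proof.
move=> mD mh mw h0 w0.
have mhD : measurable_fun setT (h \_ D) by exact/(measurable_restrictT _ _).1.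
have mwD : measurable_fun setT (w \_ D) by exact/(measurable_restrictT _ _).1.
have hD0 x : 0 <= (h \_ D) x by exact: erestrict_ge0.
have wD0 x : 0 <= (w \_ D) x by exact: erestrict_ge0.
(* The subgraph of h, which is empty outside D because h is extended by 0. *)
pose S : set (T * R) :=
  [set p : T * R | (0 <= p.2)%R /\ p.2%:E < (h \_ D) p.1].
have mS : measurable S.
  rewrite (_ : S = (snd @^-1` `[0%R, +oo[) `&`
    (setT `&` [set p : T * R | p.2%:E < (h \_ D) p.1])); last first.
    by apply/seteqP; split=> p /=; rewrite in_itv/= andbT => -[//? []].
  apply: measurableI.
    by rewrite -[X in measurable X]setTI; exact: measurable_snd.
  by apply: measurable_lte => //;
    [exact/measurable_EFinP|exact: measurableT_comp].
pose F (p : T * R) := (w \_ D) p.1 * (\1_S p)%:E.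
have mF : measurable_fun setT F.
  apply: emeasurable_funM; first exact: measurableT_comp.
  by apply/measurable_EFinP; exact: measurable_indic.
have F0 p : 0 <= F p by apply: mule_ge0 => //; rewrite lee_fin.
have -> : \int[nu]_(x in D) (h x * w x) = \int[nu]_x \int[mu]_l F (x, l).
  rewrite integral_mkcond; apply: eq_integral => x _; rewrite /F /=.
  rewrite ge0_integralZl//; last first.
    by apply/measurable_EFinP; apply: measurable_fun_pair2; exact: measurable_indic.
  have mSx : measurable [set l : R | S (x, l)].
    rewrite (_ : [set l | _] = xsection S x); first exact: measurable_xsection.
    by apply/seteqP; split=> l; rewrite /xsection/= inE.
  rewrite [X in _ * X](integral_indic mu measurableT mSx) setIT.
  rewrite [X in _ * X](lebesgue_measure_below (hD0 x)) !patchE.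
  by case: ifPn; rewrite ?mul0e// muleC.
rewrite fubini_tonelli// [RHS]integral_mkcond; apply: eq_integral => l _.
rewrite patchE; case: ifPn => [|l0]; last first.
  apply: integral0_eq => x _; rewrite /F/= indicE memNset ?mule0//.
  by move=> -[/= {}l0' _]; move: l0; rewrite notin_setE/= in_itv/= andbT l0'.
rewrite inE/= in_itv/= andbT => l0.
rewrite [RHS]integral_mkcond; apply: eq_integral => x _.
rewrite /F/= indicE !patchE in_setI; case: ifPn => /= xD; last by rewrite mul0e.
have -> : ((x, l) \in S) = (x \in [set x | l%:E < h x]).
  by apply/idP/idP; rewrite !inE /S/= patchE xD => // -[].
by case: ifPn => _; rewrite ?mule1 ?mule0.
Qed.

End layer_cake.

Section monotone.
Context {R : realType}.

Lemma emeasurable_nonincreasing (D : set R) (f : R -> \bar R) :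
  is_interval D ->
  (forall s t, D s -> D t -> s <= t -> (f t <= f s)%E) -> measurable_fun D f.
Proof.
move=> iD f_ni.
apply: (measurability _ (ErealGenOInfty.measurableE R)) => _ /= [_] [r] -> <-.
apply: is_interval_measurable => s t /= [Ds fs] [Dt ft] u /andP[su ut].
have Du : D u by apply: (iD s t) => //; rewrite su ut.
split=> //; move: fs ft; rewrite /= !in_itv/= !andbT => fs ft.
by rewrite (lt_le_trans ft)// f_ni.
Qed.

End monotone.

(** * Weights *)

Section weights.
Context {R : realType}.
Variable gamma : \bar R.
Implicit Types (w : R -> R) (t : R).
Notation mu := (@lebesgue_measure R).
Notation D := (base_itv0 gamma).

Lemma base_itv0P t : D t <-> 0 < t /\ (t%:E < gamma)%E.
Proof.
split=> [[[t0 tg] /eqP tn0]|[t0 tg]].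
  by split=> //; rewrite lt_neqAle eq_sym tn0.
by split; [split=> //; exact: ltW|apply/eqP; rewrite gt_eqF].
Qed.

Lemma base_itv0_nonempty : (0 < gamma)%E -> exists t, D t.
Proof.
move=> g0; suff [t t0 tg] : exists2 t : R, 0 < t & (t%:E < gamma)%E.
  by exists t; apply/base_itv0P.
case: gamma g0 => [r| |]//; last by exists 1; rewrite ?ltry.
rewrite lte_fin => r0; exists (r / 2); first by rewrite divr_gt0.
by rewrite lte_fin ltr_pdivrMr// ltr_pMr// ltr1n.
Qed.

Lemma is_interval_base_itv0 : is_interval D.
Proof.
move=> s t /base_itv0P[s0 _] /base_itv0P[_ tg] u /andP[su ut].
apply/base_itv0P; split; first exact: lt_le_trans su.
by rewrite (le_lt_trans _ tg).
Qed.

Lemma measurable_base_itv0 : measurable D.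
Proof. by apply: is_interval_measurable; exact: is_interval_base_itv0. Qed.

Lemma sub_base_itv0 t : base_itv gamma t -> `]0, t[ `<=` D.
Proof.
move=> [_ tg] s /=; rewrite in_itv/= => /andP[s0 st].
by apply/base_itv0P; split=> //; rewrite (lt_trans _ tg)// lte_fin.
Qed.

Lemma measurable_weight w : weight_fun gamma w ->
  measurable_fun D (EFin \o w).
Proof.
move=> ww; apply: emeasurable_nonincreasing; first exact: is_interval_base_itv0.
by move=> s t Ds Dt st /=; rewrite lee_fin; exact: (weight_noninc ww).
Qed.

Lemma weight_ge0 w t : weight_fun gamma w -> D t -> (0 <= (w t)%:E)%E.
Proof. by move=> ww Dt; rewrite lee_fin ltW//; exact: (weight_gt0 ww). Qed.

Lemma weight_int_ge0 w t : weight_fun gamma w -> base_itv gamma t ->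
  (0 <= weight_int w t)%E.
Proof.
move=> ww It; apply: integral_ge0 => s st; apply: weight_ge0 => //.
exact: sub_base_itv0 st.
Qed.

(** Monotone convergence along the intervals ]0, r - 1/(n+1)]. It reaches the
    right end of a bounded interval, where the comparison of the primitives of
    the weights is not assumed. *)
Lemma integral_oo_le (f : R -> \bar R) (r : R) (M : \bar R) :
  measurable_fun `]0, r[ f -> (forall t, 0 < t < r -> (0 <= f t)%E) ->
  (0 <= M)%E ->
  (forall t, 0 < t < r -> (\int[mu]_(s in `]0%R, t[) f s <= M)%E) ->
  (\int[mu]_(s in `]0%R, r[) f s <= M)%E.
Proof.
move=> mf f0 M0 fM.
pose F (n : nat) := `]0, r - n.+1%:R^-1]%classic : set R.
have Fsub n : F n `<=` `]0, r[.
  by rewrite itv_bnd_open_bigcup => s; exists n.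
have ndF : nondecreasing_seq F.
  move=> m n mn; rewrite subsetEset => s; rewrite /F/= !in_itv/=.
  move=> /andP[-> /le_trans->]//; rewrite lerD2l lerN2.
  by rewrite lef_pV2 ?posrE// ler_nat.
have mF n : measurable (F n) by exact: measurable_itv.
have mfF n : measurable_fun (F n) f by exact: measurable_funS (Fsub n) mf.
have f0F n s : F n s -> (0 <= f s)%E.
  by move=> /Fsub/=; rewrite in_itv/=; exact: f0.
rewrite itv_bnd_open_bigcup.
rewrite -(cvg_lim _ (ge0_nondecreasing_set_cvg_integral (mu := mu) ndF mF mfF f0F))//.
apply: lime_le.
  apply: ereal_nondecreasing_is_cvgn.
  exact: ge0_nondecreasing_set_nondecreasing_integral.
apply: nearW => n; have [r0|r0] := ltP 0 (r - n.+1%:R^-1); last first.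
  by rewrite /F set_itv_ge ?integral_set0// bnd_simp -leNgt.
rewrite -integral_itv_bndo_bndc.
  by apply: fM; rewrite r0/= gtrBl invr_gt0.
by apply: measurable_funS (mfF n) => //; apply: subset_itvl; rewrite bnd_simp.
Qed.

(** The set A and the open interval differ at most by the null set {c}. *)
Lemma integral_lower_set_bounded w (A : set R) (c : R) :
  weight_fun gamma w -> D c -> `]0, c[ `<=` A -> A `<=` `]0, c] ->
  (\int[mu]_(s in A) (w s)%:E = weight_int w c)%E.
Proof.
move=> ww Dc cA Ac; rewrite /weight_int.
have [Acc|Acc] := pselect (A c).
  rewrite (_ : A = `]0, c]%classic) ?(integral_itv_bndo_bndc (f := EFin \o w))//.
    apply: measurable_funS (measurable_weight ww).
      exact: measurable_base_itv0.
    by apply: sub_base_itv0; case: Dc.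
  apply/seteqP; split=> // s /=; rewrite in_itv/= => /andP[s0].
  rewrite le_eqVlt => /predU1P[->//|sc].
  by apply: cA; rewrite /= in_itv/= s0.
congr (integral _ _ _); apply/seteqP; split=> // s As.
have /= := Ac _ As; rewrite !in_itv/= => /andP[->].
by rewrite le_eqVlt => /predU1P[sc|->//]; rewrite sc in As.
Qed.

(** An initial segment A that is bounded by a point of the interval is, up to
    its right end, ]0, sup A[, and the hypothesis applies at sup A. Otherwise A
    is the whole interval: if it is unbounded, w1 has infinite integral, and if
    it is bounded, the comparison passes to the limit at the right end. *)
Lemma integral_lower_set_le w1 w2 (K : R) (A : set R) :
  weight_fun gamma w1 -> weight_fun gamma w2 -> 0 < K ->
  (forall t, base_itv gamma t -> (weight_int w2 t <= K%:E * weight_int w1 t)%E) ->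
  A `<=` D -> (forall s t, D s -> A t -> s <= t -> A s) ->
  (\int[mu]_(s in A) (w2 s)%:E <= K%:E * \int[mu]_(s in A) (w1 s)%:E)%E.
Proof.
move=> ww1 ww2 K0 KW AD lowA.
have [->|/set0P[a Aa]] := eqVneq A set0; first by rewrite !integral_set0 mule0.
have [[c [Dc Ac]]|nbA] := pselect (exists c, D c /\ ubound A c).
  have supA : has_sup A by split; [exists a|exists c].
  have a_le : a <= sup A by apply: ub_le_sup => //; exists c.
  have Ds : D (sup A).
    have := is_interval_base_itv0 (AD _ Aa) Dc; apply.
    by rewrite a_le/= ge_sup//; exists a.
  have cA : `]0, sup A[ `<=` A.
    move=> s /= /[dup] ss; rewrite in_itv/= => /andP[_ sA].
    have [t At st] := @sup_gt _ A s (ex_intro _ a Aa) sA.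
    apply: (lowA s t) => //; last exact: ltW.
    by apply: sub_base_itv0 ss; case: Ds.
  have Ac' : A `<=` `]0, sup A].
    move=> s As; rewrite /= in_itv/=; have /base_itv0P[-> _] := AD _ As.
    by rewrite ub_le_sup//; exists c.
  rewrite !(@integral_lower_set_bounded _ A (sup A))//.
  by apply: KW; case: Ds.
have {lowA nbA} -> : A = D.
  apply/seteqP; split=> // s Ds; apply: contrapT => nAs; apply: nbA.
  exists s; split=> // t At; rewrite leNgt; apply/negP => /ltW st.
  exact/nAs/(lowA s t).
have [goo|gfin] := eqVneq gamma +oo%E.
  rewrite [X in (_ * X)%E](_ : _ = +oo%E) ?gt0_muley ?leey//.
  rewrite -(weight_oo ww1 goo); congr (integral _ _ _).
  apply/seteqP; split=> t; rewrite /= in_itv/= andbT; first by case/base_itv0P.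
  by move=> t0; apply/base_itv0P; rewrite goo ltry.
have g0 : (0 < gamma)%E.
  by have /base_itv0P[a0] := AD _ Aa; apply: lt_trans; rewrite lte_fin.
have gE : gamma = (fine gamma)%:E by rewrite fineK// gt0_fin_numE// lt_neqAle gfin leey.
have DE : D = `]0, fine gamma[%classic.
  apply/seteqP; split=> t; rewrite /= in_itv/=.
    by move=> /base_itv0P[->]; rewrite gE lte_fin.
  by move=> /andP[t0 tg]; apply/base_itv0P; rewrite gE lte_fin.
rewrite [X in (X <= _)%E](_ : _ = \int[mu]_(s in `]0%R, fine gamma[) (w2 s)%:E)%E ?DE//.
apply: integral_oo_le.
- by rewrite -DE; exact: measurable_weight.
- by move=> t t0g; apply: (weight_ge0 ww2); rewrite DE/= in_itv.
- apply: mule_ge0; first by rewrite lee_fin ltW.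
  by apply: integral_ge0 => t; rewrite -DE; exact: weight_ge0.
move=> t t0g; have Dt : D t by rewrite DE/= in_itv.
apply: (le_trans (KW t _)); first by case: Dt.
rewrite lee_pmul2l//; apply: ge0_subset_integral => //.
- by rewrite -DE; exact: measurable_weight.
- by move=> s; rewrite -DE; exact: weight_ge0.
- by apply: subset_itvl; rewrite bnd_simp; case/andP: t0g => _ /ltW.
Qed.

(** By the layer cake formula it is enough to compare the integrals of the
    weights over the superlevel sets of h, which are initial segments. *)
Lemma weighted_integral_le w1 w2 (K : R) (h : R -> \bar R) :
  weight_fun gamma w1 -> weight_fun gamma w2 -> 0 < K ->
  (forall t, base_itv gamma t -> (weight_int w2 t <= K%:E * weight_int w1 t)%E) ->
  (forall t, D t -> (0 <= h t)%E) ->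
  (forall s t, D s -> D t -> s <= t -> (h t <= h s)%E) ->
  (\int[mu]_(t in D) (h t * (w2 t)%:E) <=
   K%:E * \int[mu]_(t in D) (h t * (w1 t)%:E))%E.
Proof.
move=> ww1 ww2 K0 KW h0 h_ni.
have mh : measurable_fun D h.
  exact: emeasurable_nonincreasing is_interval_base_itv0 h_ni.
have layerE w : weight_fun gamma w ->
    (\int[mu]_(t in D) (h t * (w t)%:E) = \int[mu]_(l in `[0%R, +oo[)
       \int[mu]_(t in D `&` [set t | l%:E < h t]) (w t)%:E)%E.
  move=> ww; apply: (ge0_integral_layer_cake mu measurable_base_itv0 mh) => //.
  - exact: measurable_weight.
  - by move=> t; exact: weight_ge0.
pose S l := D `&` [set t | (l%:E < h t)%E].
have mS l : measurable (S l).
  exact: (emeasurable_fun_o_infty measurable_base_itv0 mh).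
have mG w : weight_fun gamma w ->
    measurable_fun (`[0%R, +oo[%classic : set R)
      (fun l : R => \int[mu]_(t in S l) (w t)%:E)%E.
  move=> ww; apply: emeasurable_nonincreasing; first exact: interval_is_interval.
  move=> l m _ _ lm; apply: ge0_subset_integral; [exact: mS|exact: mS|..].
  - apply: measurable_funS (measurable_weight ww) => //.
      exact: measurable_base_itv0.
    exact: subIsetl.
  - by move=> t [Dt _]; exact: weight_ge0.
  - by move=> t [Dt /= mt]; split=> //=; rewrite (le_lt_trans _ mt)// lee_fin.
have G0 w l : weight_fun gamma w -> (0 <= \int[mu]_(t in S l) (w t)%:E)%E.
  by move=> ww; apply: integral_ge0 => t [Dt _]; exact: weight_ge0.
rewrite !layerE// -ge0_integralZl//; first last.
- by rewrite lee_fin ltW.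
- by move=> l _; exact: G0.
- exact: mG.
apply: ge0_le_integral => //.
- by move=> l _; exact: G0.
- exact: mG.
- by apply: measurable_funeM; exact: mG.
- move=> l _; apply: integral_lower_set_le => //.
  move=> s t Ds [Dt /= lt] st; split=> //=; rewrite (lt_le_trans lt)//.
  exact: h_ni.
Qed.

Lemma weight_int_gt0 w t : weight_fun gamma w -> D t -> (0 < weight_int w t)%E.
Proof.
move=> ww Dt; have /base_itv0P[t0 _] := Dt.
have It : base_itv gamma t by case: Dt.
apply: (@lt_le_trans _ _ (\int[mu]_(s in `]0%R, t[) (w t)%:E)%E).
  rewrite integral_cst//= lebesgue_measure_itv/= lte_fin t0 oppr0 adde0.
  by rewrite mule_gt0// lte_fin (weight_gt0 ww).
apply: ge0_le_integral => //.
- by move=> s _; rewrite lee_fin ltW// (weight_gt0 ww).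
- apply: measurable_funS (measurable_weight ww) => //.
    exact: measurable_base_itv0.
  exact: sub_base_itv0.
- move=> s st; have Ds := sub_base_itv0 It st.
  by rewrite lee_fin (weight_noninc ww)//; move: st;
    rewrite /= in_itv/= => /andP[_ /ltW].
Qed.

(** The primitive is finite at the midpoint c of the interval, and beyond c the
    weight is at most w c. *)
Lemma weight_int_bounded w : weight_fun gamma w -> (0 < gamma < +oo)%E ->
  exists2 M : R, 0 < M & forall t, base_itv gamma t -> (weight_int w t <= M%:E)%E.
Proof.
move=> ww /andP[g0 gy]; have gE : gamma = (fine gamma)%:E.
  by rewrite fineK// gt0_fin_numE.
pose c := fine gamma / 2.
have fg0 : 0 < fine gamma by rewrite -lte_fin -gE.
have Dc : D c.
  apply/base_itv0P; split; first by rewrite divr_gt0.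
  by rewrite gE lte_fin ltr_pdivrMr// ltr_pMr// ltr1n.
have Ic : base_itv gamma c by case: Dc.
have c0 : 0 < c by case/base_itv0P : Dc.
have wc0 : 0 < w c by exact: (weight_gt0 ww).
have Wc : weight_int w c = (fine (weight_int w c))%:E.
  by rewrite fineK// ge0_fin_numE ?(weight_fin ww) ?weight_int_ge0.
exists (fine (weight_int w c) + w c * fine gamma).
  rewrite ltr_wpDl ?mulr_gt0// -lee_fin -Wc; exact: weight_int_ge0.
move=> t It; have tg : t < fine gamma by case: It => _; rewrite gE lte_fin.
have mw A : A `<=` D -> measurable_fun A (EFin \o w).
  move=> AD; apply: measurable_funS (measurable_weight ww) => //.
  exact: measurable_base_itv0.
have sub_le (a b : R) : base_itv gamma b -> a <= b ->
    (weight_int w a <= weight_int w b)%E.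
  move=> Ib ab; apply: ge0_subset_integral => //.
  - by apply: mw; exact: sub_base_itv0.
  - by move=> s st; apply: weight_ge0 => //; exact: sub_base_itv0 st.
  - by apply: subset_itvl; rewrite bnd_simp.
rewrite EFinD -Wc; have [tc|ct] := leP t c.
  rewrite (le_trans (sub_le _ _ Ic tc))// leeDl// lee_fin.
  by rewrite mulr_ge0 ?ltW.
have tE : `]0, t[%classic = `]0, c[ `|` `[c, t[ :> set R.
  by apply: itv_bndbnd_setU; rewrite bnd_simp// ltW.
rewrite /weight_int tE ge0_integral_setU//; first last.
- apply/disj_setPS => s [] /=; rewrite !in_itv/= => /andP[_ sc] /andP[cs _].
  by move: cs; rewrite leNgt sc.
- by rewrite -tE => s st; apply: weight_ge0 => //; exact: sub_base_itv0 st.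
- by rewrite -tE; apply: mw; exact: sub_base_itv0.
apply: leeD => //.
have ctD : `[c, t[ `<=` D.
  by apply: subset_trans (sub_base_itv0 It); rewrite tE; exact: subsetUr.
apply: (@le_trans _ _ (\int[mu]_(s in `[c, t[) (w c)%:E)%E).
  apply: ge0_le_integral => //.
  - by move=> s st; apply: weight_ge0 => //; exact: ctD.
  - exact: mw.
  - move=> s st; rewrite lee_fin; apply: (weight_noninc ww) => //.
      exact: ctD.
    by move: st; rewrite /= in_itv/= => /andP[].
rewrite integral_cst//= lebesgue_measure_itv/= lte_fin ct -EFinB -EFinM lee_fin.
rewrite ler_pM2l// (le_trans _ (ltW tg))// gerBl ltW//.
Qed.

End weights.

(** * Orlicz functions and doubling *)

Section orlicz_functions.
Context {R : realType}.
Variable phi : R -> R.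
Hypothesis phiO : orlicz_fun phi.

(** Convexity between u and 0, where phi vanishes. *)
Lemma orlicz_scale (c u : R) : 0 <= c <= 1 -> 0 <= u -> phi (c * u) <= c * phi u.
Proof.
move=> /andP[c0 c1] u0.
have /(_ (Itv01 c0 c1) u 0) := orlicz_convex phiO.
rewrite !inE/= !in_itv/= u0 lexx => /(_ isT isT).
rewrite convRE (orlicz0 phiO) mulr0 addr0 [X in phi X](_ : _ = c * u)//.
by transitivity (c * u + (1 - c) * 0) => //; rewrite mulr0 addr0.
Qed.

Lemma orlicz_le (u v : R) : 0 <= u -> u <= v -> phi u <= phi v.
Proof.
move=> u0; rewrite le_eqVlt => /predU1P[->//|uv].
have v0 : 0 < v by exact: le_lt_trans uv.
have c1 : u / v <= 1 by rewrite ler_pdivrMr// mul1r ltW.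
rewrite -[in phi u](divfK (lt0r_neq0 v0) u).
rewrite (le_trans (orlicz_scale _ (ltW v0)))//.
  by rewrite divr_ge0//= ltW.
by rewrite ler_piMl// (orlicz_ge0 phiO)// ltW.
Qed.

Lemma orlicz_ge_linear (u : R) : 1 <= u -> u * phi 1 <= phi u.
Proof.
move=> u1; have u0 : 0 < u by exact: lt_le_trans u1.
rewrite -ler_pdivlMl// -[in phi 1](mulVf (lt0r_neq0 u0)).
apply: orlicz_scale; last exact: ltW.
by rewrite invr_ge0 ltW//= invf_le1.
Qed.

Lemma extend_oo_ge0 (x : \bar R) : (0 <= x)%E -> (0 <= extend_oo phi x)%E.
Proof. by case: x => [r| |]//=; rewrite !lee_fin; exact: orlicz_ge0. Qed.

Lemma extend_oo_le (x y : \bar R) : (0 <= x)%E -> (x <= y)%E ->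
  (extend_oo phi x <= extend_oo phi y)%E.
Proof.
case: y => [y| |] x0 xy; rewrite ?leey//.
by case: x x0 xy => [x| |]//; rewrite !lee_fin; exact: orlicz_le.
Qed.

Lemma extend_oo_scale (c : R) (x : \bar R) : 0 < c <= 1 -> (0 <= x)%E ->
  (extend_oo phi (c%:E * x) <= c%:E * extend_oo phi x)%E.
Proof.
move=> /andP[c0 c1]; case: x => [x| |]// x0.
  by rewrite /= -EFinM lee_fin orlicz_scale// ltW.
by rewrite gt0_muley// leey.
Qed.

(** Any element s of { s | phi s * W <= 1 } above half of its supremum works,
    because 2 s then exceeds the supremum. The supremum is finite since phi
    grows at least linearly, and positive by [orlicz_scale]. *)
Lemma orlicz_crossing (W : R) : 0 < W ->
  exists2 s, 0 < s & phi s * W <= 1 < phi (2 * s) * W.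
Proof.
move=> W0; have p1 := orlicz_gt0 phiO ltr01.
pose S := [set s | 0 <= s /\ phi s * W <= 1].
have bndS : ubound S (Num.max 1 (W * phi 1)^-1).
  move=> s [s0 sW]; rewrite le_max; have [//|s1] := leP s 1.
  rewrite -[leRHS]mul1r ler_pdivlMr ?mulr_gt0// (le_trans _ sW)//=.
  rewrite mulrCA mulrC ler_pM2r//; apply: orlicz_ge_linear; exact: ltW.
have supS : has_sup S.
  split; last by exists (Num.max 1 (W * phi 1)^-1).
  by exists 0; split=> //; rewrite (orlicz0 phiO) mul0r.
pose c := Num.min 1 (W * phi 1)^-1.
have c0 : 0 < c by rewrite lt_min ltr01 invr_gt0 mulr_gt0.
have Sc : S c.
  split; first exact: ltW.
  rewrite -[c]mulr1 (@le_trans _ _ (c * phi 1 * W))//.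
    rewrite ler_pM2r//; apply: orlicz_scale => //.
    by rewrite ltW//= ge_min lexx.
  by rewrite -mulrA (mulrC _ W) -ler_pdivlMr ?mulr_gt0// mul1r ge_min lexx orbT.
have sup0 : 0 < sup S by rewrite (lt_le_trans c0)// ub_le_sup//; case: supS.
have [s Ss sups] : exists2 s, S s & sup S / 2 < s.
  apply: sup_gt; first by exists c.
  by rewrite ltr_pdivrMr// ltr_pMr// ltr1n.
exists s; first by rewrite (lt_trans _ sups)// divr_gt0.
case: Ss => s0 ->/=; rewrite ltNge; apply/negP => s2W.
have : 2 * s <= sup S by apply: ub_le_sup; [case: supS|split=> //; rewrite mulr_ge0].
by rewrite leNgt mulrC -ltr_pdivrMr// sups.
Qed.

(** On the segment [a, u0] that is not covered by the hypothesis, monotonicity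
    gives phi (2 u) <= phi (2 u0) and phi a <= phi u. *)
Lemma delta2_oo_away0 (a : R) : delta2_oo phi -> 0 < a ->
  exists2 K, 0 < K & forall u, a <= u -> phi (2 * u) <= K * phi u.
Proof.
move=> [K [u0 [K2 u00 phiK]]] a0.
have pa := orlicz_gt0 phiO a0.
have K0 : 0 < K by exact: lt_trans K2.
exists (Num.max K (phi (2 * u0) / phi a)); first by rewrite lt_max K0.
move=> u au; have up : 0 < u by exact: lt_le_trans au.
have pu := orlicz_gt0 phiO up.
have [u0u|uu0] := leP u0 u.
  by rewrite (le_trans (phiK _ u0u))// ler_pM2r// le_max lexx.
apply: (@le_trans _ _ (phi (2 * u0))).
  by apply: orlicz_le; [rewrite mulr_ge0// ltW|rewrite ler_pM2l// ltW].
apply: (@le_trans _ _ (phi (2 * u0) / phi a * phi u)).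
  rewrite -mulrA ler_peMr ?(orlicz_ge0 phiO) ?mulr_ge0//.
  by rewrite mulrC ler_pdivlMr// mul1r orlicz_le// ltW.
by rewrite ler_pM2r// le_max lexx orbT.
Qed.

Lemma delta2_global : delta2 phi ->
  exists2 K, 0 < K & forall u, 0 <= u -> phi (2 * u) <= K * phi u.
Proof.
move=> [doo [K [u0 [K2 u00 phiK]]]].
have [L L0 phiL] := delta2_oo_away0 doo u00.
exists (Num.max K L); first by rewrite lt_max L0 orbT.
move=> u up; have pu := orlicz_ge0 phiO up.
have [uu0|/ltW uu0] := leP u u0.
  by rewrite (le_trans (phiK u _)) ?up// ler_wpM2r// le_max lexx.
by rewrite (le_trans (phiL u _))// ler_wpM2r// le_max lexx orbT.
Qed.

(** Doubling n times suffices as soon as C <= 2 ^ n; the arguments met on the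
    way stay in [a, +oo[. *)
Lemma doubling_iter (a K C : R) : 0 <= a -> 0 < K ->
  (forall u, a <= u -> phi (2 * u) <= K * phi u) -> 0 <= C ->
  exists2 L, 0 < L & forall u, a <= u -> phi (C * u) <= L * phi u.
Proof.
move=> a0 K0 phiK C0.
have phi_iter n u : a <= u -> phi (2 ^+ n * u) <= K ^+ n * phi u.
  move=> au; elim: n => [|n IHn]; first by rewrite !expr0 !mul1r.
  rewrite !exprS -!mulrA (le_trans (phiK _ _)) ?ler_pM2l//.
  by rewrite (le_trans au)// ler_peMl ?exprn_ege1 ?ler1n// (le_trans a0).
pose n := Num.bound C.
exists (K ^+ n); first exact: exprn_gt0.
move=> u au; apply: le_trans (phi_iter n u au); apply: orlicz_le.
  by rewrite mulr_ge0// (le_trans a0).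
apply: ler_wpM2r; first exact: le_trans au.
apply: (@le_trans _ _ n%:R).
  exact: ltW (archi_boundP C0).
by rewrite -natrX ler_nat ltnW// ltn_expl.
Qed.

End orlicz_functions.

(** * Comparison of modulars *)

Section modular.
Context {R : realType}.
Variable gamma : \bar R.
Variable phi : R -> R.
Hypothesis phiO : orlicz_fun phi.
Implicit Types (w f g : R -> R).
Notation D := (base_itv0 gamma).

Lemma rearrangement_ge0 f t : (0 <= rearrangement gamma f t)%E.
Proof.
by apply: le_ereal_inf_tmp => _ [l [l0 _] <-]; rewrite lee_fin ltW.
Qed.

Lemma rearrangement_nonincreasing f s t : s <= t ->
  (rearrangement gamma f t <= rearrangement gamma f s)%E.
Proof.
move=> st; apply: ereal_inf_le_tmp => _ [l [l0 fl] <-]; exists l => //.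
by split=> //; rewrite (le_trans fl)// lee_fin.
Qed.

(** If l is admissible for f then c * l is admissible for c f. *)
Lemma rearrangement_scale f (c t : R) : 0 < c ->
  (rearrangement gamma (fun s => c * f s)%R t <= c%:E * rearrangement gamma f t)%E.
Proof.
move=> c0; rewrite -lee_pdivrMl//; apply: le_ereal_inf_tmp => _ [l [l0 fl] <-].
rewrite lee_pdivrMl//; apply: ereal_inf_lbound; exists (c * l) => //.
split; first exact: mulr_gt0.
rewrite (le_trans _ fl)// /distr_fun [X in (leb_itv _ X <= _)%E](_ : _ =
  [set s | l < `|f s|])//.
by apply/seteqP; split=> s /=; rewrite normrM (gtr0_norm c0) ltr_pM2l.
Qed.

Let h f t := extend_oo phi (rearrangement gamma f t).

Let h_ge0 f t : (0 <= h f t)%E.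
Proof. by apply: extend_oo_ge0 => //; exact: rearrangement_ge0. Qed.

Let h_nonincreasing f s t : s <= t -> (h f t <= h f s)%E.
Proof.
move=> st; apply: (extend_oo_le phiO); first exact: rearrangement_ge0.
exact: rearrangement_nonincreasing.
Qed.

Let measurable_h f : measurable_fun D (h f).
Proof.
apply: emeasurable_nonincreasing; first exact: is_interval_base_itv0.
by move=> s t _ _; exact: h_nonincreasing.
Qed.

Lemma modular_le_weight w1 w2 (K : R) f :
  weight_fun gamma w1 -> weight_fun gamma w2 -> 0 < K ->
  (forall t, base_itv gamma t -> (weight_int w2 t <= K%:E * weight_int w1 t)%E) ->
  (modular gamma phi w2 f <= K%:E * modular gamma phi w1 f)%E.
Proof.
move=> ww1 ww2 K0 KW; apply: weighted_integral_le => // [t _|s t _ _].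
  exact: h_ge0.
exact: h_nonincreasing.
Qed.

Lemma modular_scale w f (c : R) : weight_fun gamma w -> 0 < c <= 1 ->
  (modular gamma phi w (fun t => c * f t)%R <= c%:E * modular gamma phi w f)%E.
Proof.
move=> ww c01; have /andP[c0 _] := c01.
have mD := measurable_base_itv0 gamma.
have mw := measurable_weight ww.
rewrite /modular -ge0_integralZl//; first last.
- by rewrite lee_fin ltW.
- by move=> t Dt; rewrite mule_ge0//; [exact: h_ge0|exact: (weight_ge0 ww)].
- by apply: emeasurable_funM => //; exact: measurable_h.
apply: ge0_le_integral => //.
- by move=> t Dt; rewrite mule_ge0//; [exact: h_ge0|exact: (weight_ge0 ww)].
- by apply: emeasurable_funM => //; exact: measurable_h.
- apply: measurable_funeM; apply: emeasurable_funM => //; exact: measurable_h.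
move=> t Dt; rewrite muleA lee_wpmul2r//; first exact: (weight_ge0 ww).
apply: le_trans (extend_oo_scale phiO c01 (rearrangement_ge0 f t)).
apply: (extend_oo_le phiO); first exact: rearrangement_ge0.
exact: rearrangement_scale.
Qed.

(** With L = max 1 K, rho_1 (h / e) <= 1 implies
    rho_2 (h / (L e)) <= rho_2 (h / e) / L <= 1, so the norm for w2 is at most L
    times the norm for w1. *)
Lemma weight_int_le_embedding w1 w2 (K : R) :
  weight_fun gamma w1 -> weight_fun gamma w2 -> 0 < K ->
  (forall t, base_itv gamma t -> (weight_int w2 t <= K%:E * weight_int w1 t)%E) ->
  orlicz_lorentz gamma phi w1 `<=` orlicz_lorentz gamma phi w2 /\
  luxemburg_continuous gamma phi w1 w2 (@idfun (L0 gamma)).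
Proof.
move=> ww1 ww2 K0 KW; split.
  move=> f [k k0 fk]; exists k => //.
  apply: le_lt_trans (modular_le_weight _ ww1 ww2 K0 KW) _.
  by rewrite lte_mul_pinfty// lee_fin ltW.
move=> f _ eps eps0; pose L := Num.max 1 K.
have L1 : 1 <= L by rewrite le_max lexx.
have L0 : 0 < L by exact: lt_le_trans L1.
exists (eps / L); first exact: divr_gt0.
move=> g _ /ereal_inf_lt[_ [e [e0 ge] <-]]; rewrite lte_fin => eL.
apply: (@le_lt_trans _ _ (e * L)%:E); last by rewrite lte_fin -ltr_pdivlMr.
apply: ereal_inf_lbound; exists (e * L) => //; split; first exact: mulr_gt0.
rewrite [X in modular _ _ _ X](_ : _ = (fun t => L^-1 * ((g t - f t) / e))); last first.
  by apply/funext => t; rewrite invfM mulrA mulrC.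
apply: le_trans (modular_scale _ ww2 _) _.
  by rewrite invr_gt0 L0 invf_le1.
rewrite lee_pdivrMl// mule1.
apply: le_trans (modular_le_weight _ ww1 ww2 K0 KW) _.
apply: (@le_trans _ _ (K%:E * 1)%E); first by rewrite lee_pmul2l.
by rewrite mule1 lee_fin le_max lexx orbT.
Qed.

End modular.

(** * Step functions and the converse *)

Section steps.
Context {R : realType}.
Variable gamma : \bar R.
Variable phi : R -> R.
Hypothesis phiO : orlicz_fun phi.
Implicit Types (w f g : R -> R).
Notation D := (base_itv0 gamma).
Notation mu := (@lebesgue_measure R).

Definition step (u t : R) : R -> R := fun s => u * \1_(`[0, t[%classic : set R) s.

Lemma measurable_step u t :
  measurable_fun [set: lebesgueType R] (step u t : lebesgueType R -> R).
Proof.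
apply: measurable_funM => //; apply: measurable_indic.
by apply: sub_caratheodory; exact: measurable_itv.
Qed.

Definition step_mfun (u t : R) : {mfun lebesgueType R >-> R} :=
  mfun_Sub (mem_set (measurable_step u t)).

Definition step_class (u t : R) : L0 gamma :=
  \pi_(L0 gamma)%qT (step_mfun u t).

Lemma step_classE u t :
  {ae leb_itv gamma, forall s, step_class u t s = step u t s}.
Proof.
rewrite /step_class /L0_fun /aqEqMfun_to_fun; case: piP => f /eqmodP/asboolP ff.
by apply: filterS ff => s /(_ Logic.I) /= <-.
Qed.

Lemma distr_fun_ae_eq f g (l : R) :
  measurable_fun [set: lebesgueType R] (f : lebesgueType R -> R) ->
  measurable_fun [set: lebesgueType R] (g : lebesgueType R -> R) ->
  {ae leb_itv gamma, forall s, f s = g s} ->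
  distr_fun gamma f l = distr_fun gamma g l.
Proof.
move=> mf mg fg.
apply: (@distr_fun_ae _ gamma (mfun_Sub (mem_set mf)) (mfun_Sub (mem_set mg)) l).
apply: filterS fg; first exact: (ae_filter_ringOfSetsType (leb_itv gamma)).
by move=> s /= fgs _.
Qed.

(** The completed measure is the Lebesgue outer measure, as is the Borel one, so
    both give the same value to every set. *)
Lemma leb_itvE (A : set R) : leb_itv gamma A = mu (A `&` base_itv gamma).
Proof. by []. Qed.

Lemma distr_fun_step u t l : 0 <= u -> 0 < l -> D t ->
  distr_fun gamma (step u t) l = if l < u then t%:E else 0%E.
Proof.
move=> u0 l0 Dt; have /base_itv0P[t0 tg] := Dt.
rewrite /distr_fun leb_itvE.
case: ifPn => lu.
  rewrite [X in _ X = _](_ : _ = `[0, t[%classic :> set R); last first.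
    apply/seteqP; split=> s /=; rewrite /step indicE.
      move=> [+ _]; have [/set_mem//|_] := boolP (s \in `[0, t[%classic).
      by rewrite mulr0 normr0 ltNge ltW.
    move=> ts; rewrite mem_set// mulr1 ger0_norm//; split=> //.
    move: ts; rewrite in_itv/= => /andP[s0 st]; split=> //.
    by rewrite (lt_trans _ tg)// lte_fin.
  by rewrite lebesgue_measure_itv/= lte_fin t0 oppr0 adde0.
rewrite [X in _ X = _](_ : _ = set0) ?measure0//.
apply/seteqP; split=> s //= [+ _]; rewrite /step indicE.
case: (s \in _); rewrite ?mulr1 ?mulr0 ?normr0.
  by rewrite ger0_norm// (negbTE lu).
by rewrite ltNge ltW.
Qed.

(** The rearrangement of u 1_[0,t) is itself, so that the integrand is
    (phi u) w on ]0, t[ and zero beyond t. *)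
Lemma modular_step w f u t : weight_fun gamma w -> 0 <= u -> D t ->
  measurable_fun [set: lebesgueType R] (f : lebesgueType R -> R) ->
  {ae leb_itv gamma, forall s, f s = step u t s} ->
  modular gamma phi w f = ((phi u)%:E * weight_int w t)%E.
Proof.
move=> ww u0 Dt mf fE; have It : base_itv gamma t by case: Dt.
have rE s : D s -> rearrangement gamma f s = (if s < t then u else 0)%:E.
  move=> Ds; have /base_itv0P[s0 _] := Ds.
  have infE (v : R) : 0 <= v ->
      ereal_inf [set l%:E | l in [set l : R | 0 < l /\ v <= l]] = v%:E.
    move=> v0; apply/eqP; rewrite eq_le; apply/andP; split.
      apply/lee_addgt0Pr => e e0; apply: ereal_inf_lbound; exists (v + e) => //.
      by split; [rewrite ltr_wpDl|rewrite lerDl ltW].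
    by apply: le_ereal_inf_tmp => _ [l [l0 vl] <-]; rewrite lee_fin.
  (* Both sides are infima of the same set of levels. *)
  rewrite -infE; last by case: ifP.
  congr (ereal_inf _); congr (_ @` _).
  have distrE l : 0 < l ->
      distr_fun gamma f l = if l < u then t%:E else 0%E.
    move=> l0; rewrite (distr_fun_ae_eq l mf (measurable_step u t) fE).
    exact: distr_fun_step.
  apply/seteqP; split=> l /= [l0]; rewrite distrE//.
    case: ltP => lu; rewrite lee_fin => ts; split=> //.
      by rewrite ltNge ts ltW.
    by case: ifP => // _; exact: ltW.
  case: ltP => st vl; split=> //; last first.
    by case: ifP => _; rewrite lee_fin// ltW.
  by rewrite ltNge vl/= lee_fin ltW.
have mw : measurable_fun `]0, t[ (EFin \o w).
  apply: measurable_funS (measurable_weight ww); first exact: measurable_base_itv0.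
  exact: sub_base_itv0.
rewrite /modular /weight_int -ge0_integralZl//; first last.
- by rewrite lee_fin (orlicz_ge0 phiO).
- by move=> s st; apply: (weight_ge0 ww); exact: sub_base_itv0 st.
rewrite [LHS]integral_mkcond [RHS]integral_mkcond.
apply: eq_integral => s _; rewrite !patchE.
case: ifPn => [/set_mem Ds|nDs]; last first.
  case: ifPn => // /set_mem st; move: nDs; rewrite notin_setE => -[].
  exact: sub_base_itv0 st.
have /base_itv0P[s0 _] := Ds.
rewrite rE//; case: ltP => st.
  by rewrite mem_set//= in_itv/= s0.
rewrite /= (orlicz0 phiO) mul0e; case: ifPn => // /set_mem/=.
by rewrite in_itv/= s0 ltNge st.
Qed.

Lemma weight_int_fineK w t : weight_fun gamma w -> base_itv gamma t ->
  weight_int w t = (fine (weight_int w t))%:E.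
Proof.
move=> ww It; rewrite fineK// ge0_fin_numE; last exact: (weight_int_ge0 ww).
exact: (weight_fin ww).
Qed.

Lemma measurable_L0 (g : L0 gamma) :
  measurable_fun [set: lebesgueType R] (g : lebesgueType R -> R).
Proof. exact: measurable_funPT. Qed.

Definition zero_class : L0 gamma := step_class 0 0.

(** A difference of representatives is only almost everywhere equal to the step
    function, which is enough by [modular_step]. *)
Lemma modular_step_class w (c u t : R) : weight_fun gamma w -> 0 <= c -> 0 <= u ->
  D t ->
  modular gamma phi w (fun s => c * (step_class u t s - zero_class s)) =
  ((phi (c * u))%:E * weight_int w t)%E.
Proof.
move=> ww c0 u0 Dt; apply: (modular_step ww (mulr_ge0 c0 u0) Dt).
  apply: measurable_funM; first exact: measurable_cst.
  by apply: measurable_funB; exact: measurable_L0.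
have FF := ae_filter_ringOfSetsType (leb_itv gamma).
move: (step_classE u t) (step_classE 0 0); apply: (@filterS2 _ _ FF) => s -> ->.
by rewrite /step mul0r subr0 mulrA.
Qed.

Lemma modular_scaled_step w (u t : R) : weight_fun gamma w -> 0 <= u ->
  D t -> modular gamma phi w (fun s => 1 * step_class u t s) =
  ((phi u)%:E * weight_int w t)%E.
Proof.
move=> ww u0 Dt; apply: (modular_step ww u0 Dt).
  apply: measurable_funM; [exact: measurable_cst|exact: measurable_L0].
have FF := ae_filter_ringOfSetsType (leb_itv gamma).
by move: (step_classE u t); apply: (@filterS _ _ FF) => s ->; rewrite mul1r.
Qed.

Lemma orlicz_lorentz_step w u t : weight_fun gamma w -> 0 <= u -> D t ->
  orlicz_lorentz gamma phi w (step_class u t).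
Proof.
move=> ww u0 Dt; exists 1 => //; rewrite modular_scaled_step//.
by rewrite (weight_int_fineK ww) ?ltry//; case: Dt.
Qed.

Lemma orlicz_lorentz_zero w t : weight_fun gamma w -> D t ->
  orlicz_lorentz gamma phi w zero_class.
Proof.
move=> ww Dt; exists 1 => //; rewrite (modular_step ww (lexx 0) Dt).
- by rewrite (orlicz0 phiO) mul0e.
- apply: measurable_funM; [exact: measurable_cst|exact: measurable_L0].
have FF := ae_filter_ringOfSetsType (leb_itv gamma).
move: (step_classE 0 0); apply: (@filterS _ _ FF) => s ->.
by rewrite mul1r /step !mul0r.
Qed.

(** Let delta be the modulus of continuity at the zero class for the value 1, and
    C = 2 / delta. If phi (C u) * W1 t <= 1, the class of u 1_[0,t) has w1-norm
    at most delta / 2 < delta, so its w2-norm is less than 1 and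
    phi (u / e) * W2 t <= 1 for some e < 1. *)
Lemma luxemburg_continuous_step w1 w2 t0 : D t0 ->
  weight_fun gamma w1 -> weight_fun gamma w2 ->
  luxemburg_continuous gamma phi w1 w2 (@idfun (L0 gamma)) ->
  exists2 C : R, 0 < C & forall u t : R, D t -> 0 <= u ->
    ((phi (C * u))%:E * weight_int w1 t <= 1)%E ->
    ((phi u)%:E * weight_int w2 t <= 1)%E.
Proof.
move=> Dt0 ww1 ww2 cont.
have [delta d0 cont0] := cont _ (orlicz_lorentz_zero ww1 Dt0) 1 ltr01.
exists (delta / 2)^-1; first by rewrite invr_gt0 divr_gt0.
move=> u t Dt u0 uW1.
have It : base_itv gamma t by case: Dt.
have modE w e : weight_fun gamma w -> 0 < e ->
    modular gamma phi w (fun s => (step_class u t s - zero_class s) / e) =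
    ((phi (e^-1 * u))%:E * weight_int w t)%E.
  move=> ww e0; have c0 : 0 <= e^-1 by rewrite invr_ge0 ltW.
  rewrite -(modular_step_class ww c0 u0 Dt); congr (modular _ _ _ _).
  by apply/funext => s; rewrite mulrC.
have /ereal_inf_lt[_ [e [e0 ge] <-]] :
    (luxemburg gamma phi w2 (fun s => step_class u t s - zero_class s)%R < 1)%E.
  apply: cont0; first exact: orlicz_lorentz_step.
  apply: (@le_lt_trans _ _ (delta / 2)%:E); last first.
    by rewrite lte_fin ltr_pdivrMr// ltr_pMr// ltr1n.
  apply: ereal_inf_lbound; exists (delta / 2) => //; split.
    by rewrite divr_gt0.
  by rewrite modE// divr_gt0.
rewrite lte_fin => e1; apply: le_trans ge; rewrite modE// lee_wpmul2r//.
  exact: (weight_int_ge0 _ It).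
rewrite lee_fin; apply: (orlicz_le phiO) => //.
by rewrite ler_peMl// invf_ge1// ltW.
Qed.

(** If gamma is infinite the doubling condition holds on all of [0, +oo[. If
    gamma is finite and W <= M, the bound 1 < phi (C u) * W t excludes C u <= x
    for an x with phi x * M <= 1, so u stays above x / C, where doubling is
    uniform. *)
Lemma delta2_region w t0 : D t0 -> weight_fun gamma w ->
  (gamma = +oo%E -> delta2 phi) -> ((gamma < +oo)%E -> delta2_oo phi) ->
  forall C : R, 0 < C -> exists2 L, 0 < L & forall u t, D t -> 0 < u ->
    (1 < (phi (C * u))%:E * weight_int w t)%E -> phi (C * u) <= L * phi u.
Proof.
move=> Dt0 ww d2 d2oo C C0; have [goo|gfin] := eqVneq gamma +oo%E.
  have [K K0 phiK] := delta2_global phiO (d2 goo).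
  have [L L0 phiL] := doubling_iter phiO (lexx 0) K0 phiK (ltW C0).
  by exists L => // u t _ u0 _; apply: phiL; exact: ltW.
have g0 : (0 < gamma)%E.
  by have /base_itv0P[a0] := Dt0; apply: lt_trans; rewrite lte_fin.
have gy : (gamma < +oo)%E by rewrite lt_neqAle gfin leey.
have [M M0 wM] : exists2 M : R, 0 < M &
    forall t, base_itv gamma t -> (weight_int w t <= M%:E)%E.
  by apply: weight_int_bounded => //; rewrite g0.
have p1 := orlicz_gt0 phiO ltr01.
pose x := Num.min 1 (M * phi 1)^-1.
have x0 : 0 < x by rewrite lt_min ltr01 invr_gt0 mulr_gt0.
have phix : phi x * M <= 1.
  rewrite -[x]mulr1 (@le_trans _ _ (x * phi 1 * M))//.
    rewrite ler_pM2r//; apply: orlicz_scale => //.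
    by rewrite ltW//= ge_min lexx.
  by rewrite -mulrA (mulrC _ M) -ler_pdivlMr ?mulr_gt0// mul1r ge_min lexx orbT.
have a0 : 0 < x / C by exact: divr_gt0.
have [K K0 phiK] := delta2_oo_away0 phiO (d2oo gy) a0.
have [L L0 phiL] := doubling_iter phiO (ltW a0) K0 phiK (ltW C0).
exists L => // u t Dt u0 uW; apply: phiL.
rewrite ler_pdivrMr// mulrC leNgt; apply/negP => ux.
move: uW; rewrite ltNge => /negP; apply.
apply: (@le_trans _ _ ((phi x)%:E * M%:E)%E); last by rewrite -EFinM lee_fin.
have It : base_itv gamma t by case: Dt.
apply: lee_pmul.
- by rewrite lee_fin (orlicz_ge0 phiO)// mulr_ge0// ltW.
- exact: (weight_int_ge0 _ It).
- by rewrite lee_fin (orlicz_le phiO)// ?mulr_ge0// ltW.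
- exact: wM.
Qed.

Lemma embedding_weight_int_le w1 w2 t0 : D t0 ->
  weight_fun gamma w1 -> weight_fun gamma w2 ->
  (gamma = +oo%E -> delta2 phi) -> ((gamma < +oo)%E -> delta2_oo phi) ->
  luxemburg_continuous gamma phi w1 w2 (@idfun (L0 gamma)) ->
  exists2 K : R, 0 < K & forall t : R, base_itv gamma t ->
    (weight_int w2 t <= K%:E * weight_int w1 t)%E.
Proof.
move=> Dt0 ww1 ww2 d2 d2oo cont.
have [C C0 stepC] := luxemburg_continuous_step Dt0 ww1 ww2 cont.
have C20 : 0 < 2 * C by exact: mulr_gt0.
have [L L0 phiL] := delta2_region Dt0 ww1 d2 d2oo C20.
exists L => // t It; have [t_eq0|/eqP t_neq0] := eqVneq t 0.
  by rewrite /weight_int t_eq0 set_itv_ge ?bnd_simp// !integral_set0 mule0.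
have Dt : D t by split.
have W1E := weight_int_fineK ww1 It; have W2E := weight_int_fineK ww2 It.
set W1 := fine _ in W1E; set W2 := fine _ in W2E.
have W10 : 0 < W1 by rewrite -lte_fin -W1E; exact: (weight_int_gt0 ww1 Dt).
have [s s0 /andP[sW sW2]] := orlicz_crossing phiO W10.
have sC0 : 0 < s / C by exact: divr_gt0.
have : ((phi (s / C))%:E * weight_int w2 t <= 1)%E.
  apply: stepC => //; first exact: ltW.
  by rewrite mulrC divfK ?lt0r_neq0// W1E -EFinM lee_fin.
have CsE : 2 * C * (s / C) = 2 * s by rewrite -mulrA (mulrC C) divfK// lt0r_neq0.
have := phiL (s / C) t Dt sC0; rewrite CsE W1E W2E -!EFinM !lee_fin lte_fin.
move=> /(_ sW2) phi2s sCW2.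
have W20 : 0 <= W2 by rewrite -lee_fin -W2E; exact: (weight_int_ge0 _ It).
rewrite -[leLHS]mulr1 (@le_trans _ _ (W2 * (phi (2 * s) * W1)))//.
  by rewrite ler_wpM2l// ltW.
rewrite (@le_trans _ _ (W2 * (L * phi (s / C) * W1)))//.
  by rewrite ler_wpM2l// ler_pM2r.
rewrite [leLHS](_ : _ = (L * W1) * (phi (s / C) * W2)); last by ring.
by rewrite ler_piMr// mulr_ge0// ltW.
Qed.

End steps.

Theorem theorem3p2 (R : realType) (gamma : \bar R) (phi w1 w2 : R -> R)
  (gamma_gt0 : (0 < gamma)%E)
  (phi_orlicz : orlicz_fun phi)
  (phi_delta2 : gamma = +oo%E -> delta2 phi)
  (phi_delta2_oo : (gamma < +oo)%E -> delta2_oo phi)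
  (w1_weight : weight_fun gamma w1) (w2_weight : weight_fun gamma w2) :
  (exists2 K : R, 0 < K &
     forall t : R, base_itv gamma t -> (weight_int w2 t <= K%:E * weight_int w1 t)%E)
  <->
  (orlicz_lorentz gamma phi w1 `<=` orlicz_lorentz gamma phi w2 /\
   luxemburg_continuous gamma phi w1 w2 (@idfun (L0 gamma))).
Proof.
split=> [[K K0 KW]|[_ cont]].
  exact: (weight_int_le_embedding phi_orlicz w1_weight w2_weight K0 KW).
have [t Dt] := base_itv0_nonempty gamma_gt0.
exact: (embedding_weight_int_le phi_orlicz Dt).
Qed.
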